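(* Let $n$ and $m$ be positive integers, let $k$ be a positive divisor of $n$, and let $d=n/k$. Then the characteristic polynomial of the Laplacian matrix $L(\mathcal{C}(n,k,m))$ is $$x(x-1)^{m-1}(x-(n+1))^{m(n-1)-k+1}(x-(md+1))\bigl(x^2-(md+n+1)x+mdn\bigr)^{k-1}.$$
   Context: For positive integers $n,m$ and a positive divisor $k$ of $n$ with $d=n/k$, $\mathcal{C}(n,k,m)=\overline{K}_k\vee_k mK_n$ is the graph with vertex set $\{u_j: j\in\mathbb{Z}_k\}\cup\{v_{t,j,s}: 1\le t\le m,\ j\in\mathbb{Z}_k,\ 1\le s\le d\}$ whose edges are: all pairs of distinct vertices $v_{t,j,s},v_{t,j',s'}$ with the same $t$ (so for each $t$ the vertices $v_{t,\cdot,\cdot}$ induce a complete graph $K_n$), and $u_jv_{t,j,s}$ for all $t,j,s$; there are no other edges (the $u_j$ are pairwise nonadjacent). The Laplacian matrix is $L(G)=D(G)-A(G)$. *)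

(* Defs.v *)
From HB Require Import structures.
From mathcomp Require Import all_boot all_order all_algebra.

Set Implicit Arguments.
Unset Strict Implicit.
Unset Printing Implicit Defensive.

Import GRing.Theory.
Local Open Scope ring_scope.

(* A simple graph on a finite type V is a symmetric irreflexive relation on V.
   Its matrices have rows and columns indexed by 'I_#|V| via [enum_val]. *)

Definition degree (V : finType) (e : rel V) (x : V) : nat :=
  #|[set y | e x y]|.

Definition adjacency_mx (R : comNzRingType) (V : finType) (e : rel V) :
    'M[R]_#|V| :=
  \matrix_(i, j) (e (enum_val i) (enum_val j))%:R.

Definition degree_mx (R : comNzRingType) (V : finType) (e : rel V) :
    'M[R]_#|V| :=
  diag_mx (\row_i (degree e (enum_val i))%:R).

Definition laplacian_mx (R : comNzRingType) (V : finType) (e : rel V) :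
    'M[R]_#|V| :=
  degree_mx R e - adjacency_mx R e.

(* [inl j] is u_j and [inr (t, j, s)] is v_{t,j,s}. The set Z_k is only used
   as an index set, so it is rendered by 'I_k; all indices start from 0. *)
Definition corona_vertex (n k m : nat) : finType :=
  ('I_k + 'I_m * 'I_k * 'I_(n %/ k))%type.

Definition corona_edge (n k m : nat) : rel (corona_vertex n k m) :=
  fun x y =>
    match x, y with
    | inl _, inl _ => false
    | inl i, inr (_, j, _) => i == j
    | inr (_, j, _), inl i => i == j
    | inr (t, j, s), inr (t', j', s') =>
        (t == t') && ((j, s) != (j', s'))
    end.

Lemma corona_edge_sym n k m : symmetric (@corona_edge n k m).
Proof.
move=> [i|[[t j] s]] [i'|[[t' j'] s']] //=.
by rewrite eq_sym [(j, s) == _]eq_sym.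
Qed.

Lemma corona_edge_irr n k m : irreflexive (@corona_edge n k m).
Proof. by move=> [i|[[t j] s]] //=; rewrite !eqxx. Qed.

(* Main.v *)
(** Write Q for the incidence matrix between the u_j and the v_{t,j,s}, and P
    for the one between the v_{t,j,s} and the m cliques. Then x I - L is the
    block matrix [[y I, Q], [Q^T, a I + P P^T]] with y = x - md and
    a = x - (n+1), and Q Q^T = md I, P^T P = n I, Q P = d J. Eliminating the
    lower left block with these three relations leaves the determinants of
    a matrix of the form alpha I + beta J and of a I + P P^T; both follow from
    Sylvester's identity a^p det(a I_q + C B) = a^q det(a I_p + B C). All the
    identities are kept free of division by multiplying through by polynomials,
    which are monic and hence can be cancelled over any commutative ring. *)

Require Import Defs.
From mathcomp Require Import all_boot all_order all_algebra.
From mathcomp Require Import perm ring zify.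

Set Implicit Arguments.
Unset Strict Implicit.
Unset Printing Implicit Defensive.

Import GRing.Theory.
Local Open Scope ring_scope.

(** * Determinant identities over a commutative ring *)

Lemma det_scalar_add_mulmxC (S : comNzRingType) (p q : nat) (a : S)
    (B : 'M_(p, q)) (C : 'M_(q, p)) :
  a ^+ p * \det (a%:M + C *m B) = a ^+ q * \det (a%:M + B *m C).
Proof.
(* Both sides equal a^p det E: eliminate one diagonal block or the other. *)
pose E := block_mx 1%:M (- B) C a%:M.
have -> : \det (a%:M + C *m B) = \det E.
  rewrite -[RHS]mulr1 -[X in _ * X](_ : \det (block_mx 1%:M B 0 1%:M) = 1).
    rewrite -det_mulmx mulmx_block !mul1mx !mulmx0 !mulmx1 !addr0 subrr.
    by rewrite det_lblock det1 mul1r addrC.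
  by rewrite det_ublock !det1 mulr1.
have dF : \det (block_mx a%:M 0 (- C) 1%:M) = a ^+ p.
  by rewrite det_lblock det1 mulr1 det_scalar.
rewrite mulrC -dF -det_mulmx mulmx_block mul1mx !mulmxN !mulNmx opprK.
rewrite !mulmx0 !mulmx1 mul_mx_scalar mul_scalar_mx add0r subrr add0r.
by rewrite det_ublock det_scalar mulrC.
Qed.

(** A constant matrix is the rank-one product of a column of ones and a constant row, so Sylvester's
    identity reduces to a 1 by 1 determinant. The extra factor [a] keeps the formula valid for
    [k = 0]. *)
Lemma det_scalar_add_const (S : comNzRingType) (k : nat) (a b : S) :
  a * \det (a%:M + const_mx b : 'M_k) = a ^+ k * (a + b *+ k).
Proof.
have := @det_scalar_add_mulmxC S 1 k a (const_mx b) (const_mx 1).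
rewrite expr1 det_mx11 !mxE eqxx mulr1n.
have -> : (const_mx 1 : 'cV_k) *m const_mx b = const_mx b :> 'M_k.
  by apply/matrixP=> i j; rewrite !mxE big_ord1 !mxE mul1r.
by under eq_bigr do rewrite !mxE mulr1; rewrite sumr_const card_ord.
Qed.

(** Rows and columns undergo the same permutation, so its sign occurs twice and cancels. This frees
    the vertices from their default enumeration. *)
Lemma det_enum_val_reindex (S : comNzRingType) (V : finType) (p : nat)
    (h : 'I_p -> V) (f : V -> V -> S) : bijective h ->
  \det (\matrix_(i < #|V|, j < #|V|) f (enum_val i) (enum_val j))
    = \det (\matrix_(i, j) f (h i) (h j)).
Proof.
move=> bij_h; have defp : p = #|V| by rewrite -(bij_eq_card bij_h) card_ord.
subst p; have inj_s : injective (fun i => enum_rank (h i)).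
  by apply: inj_comp (bij_inj bij_h); apply: enum_rank_inj.
set M := (X in \det X = _).
have -> : \matrix_(i, j) f (h i) (h j)
    = row_perm (perm inj_s) (col_perm (perm inj_s) M).
  by apply/matrixP=> i j; rewrite !mxE !permE !enum_rankK.
rewrite row_permE col_permE !det_mulmx !det_perm odd_permV.
by rewrite mulrCA -signr_addb addbb mulr1.
Qed.

Lemma natr_degree (S : comNzRingType) (V : finType) (e : rel V) (x : V) :
  (degree e x)%:R = \sum_y (e x y)%:R :> S.
Proof.
rewrite /degree -sum1_card natr_sum big_mkcond /=.
by apply: eq_bigr => y _; rewrite inE; case: (e x y).
Qed.

Lemma sum_prod3 (S : nmodType) (A B C : finType) (F : A * B * C -> S) :
  \sum_p F p = \sum_a \sum_b \sum_c F (a, b, c).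
Proof. by rewrite pair_bigA pair_bigA; apply: eq_bigr => -[[]]. Qed.

Lemma sum_eq_mulr (S : pzSemiRingType) (I : finType) (i : I) (F : I -> S) :
  \sum_j (j == i)%:R * F j = F i.
Proof.
rewrite (bigD1 i) //= eqxx mul1r big1 ?addr0 // => j /negPf->.
by rewrite mul0r.
Qed.

(** Each multiplier on the left has its source: [c * b] comes from [det_scalar_add_const],
    [(a * c) ^+ k] is the determinant of the eliminating matrix [F], and [a ^+ m] comes from
    Sylvester's identity applied to [W]. *)
Lemma det_bordered_gram (S : comNzRingType) (k m q : nat) (y a r n e : S)
    (Q : 'M_(k, q)) (P : 'M_(q, m)) :
  Q *m Q^T = r%:M -> P^T *m P = n%:M -> Q *m P = const_mx e ->
  let b := a * y - r in let c := a + n in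
  c * b * ((a * c) ^+ k * a ^+ m
           * \det (block_mx y%:M Q Q^T (a%:M + P *m P^T)))
    = a ^+ q * c ^+ m * ((c * b) ^+ k * (c * b + (e ^+ 2 *+ m) *+ k)).
Proof.
move=> QQ PP QP b c; set W := a%:M + _; set M := block_mx _ _ _ _.
have dW : a ^+ m * \det W = a ^+ q * c ^+ m.
  by rewrite det_scalar_add_mulmxC PP -raddfD /= det_scalar.
pose X := P *m P^T *m Q^T.
(* As (a I + P P^T)(c I - P P^T) = a c I, the lower left block of F is
   - a c times the solution Z of (a I + P P^T) Z = Q^T. *)
pose F := block_mx (a * c)%:M 0 (X - c *: Q^T) 1%:M : 'M_(k + q).
have QX : Q *m X = const_mx (e ^+ 2 *+ m).
  rewrite /X -mulmxA mulmxA QP -trmx_mul QP.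
  apply/matrixP=> i j; rewrite !mxE.
  by under eq_bigr do rewrite !mxE; rewrite sumr_const card_ord expr2.
have PX : P *m P^T *m X = n *: X.
  by rewrite /X !mulmxA -(mulmxA P) PP mul_mx_scalar -!scalemxAl.
have MF : M *m F = block_mx ((c * b)%:M + const_mx (e ^+ 2 *+ m)) Q 0 W.
  rewrite mulmx_block !mulmx0 !mulmx1 !add0r; congr block_mx.
    rewrite mulmxBr QX -scalemxAr QQ -scalar_mxM scale_scalar_mx.
    rewrite addrCA addrC -raddfB; congr (_%:M + _).
    by rewrite /b; ring.
  rewrite mul_mx_scalar mulmxBr -scalemxAr /W !mulmxDl PX !mul_scalar_mx -/X.
  by rewrite /c; apply/matrixP=> i j; rewrite !mxE; ring.
have := congr1 determinant MF.
rewrite det_mulmx det_lblock det1 mulr1 det_scalar det_ublock => dM.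
have := det_scalar_add_const k (c * b) (e ^+ 2 *+ m).
move: (\det W) (\det M) (\det (_ + const_mx _)) dW dM => w D D' ew eD eD'.
transitivity (a ^+ m * (c * b) * (D * (a * c) ^+ k)); first by ring.
by rewrite eD -ew -eD'; ring.
Qed.

(** * Degrees and incidence matrices of the corona *)

Section Corona.

Variables (S : comNzRingType) (n k m : nat).
Hypothesis k_dvd_n : (k %| n)%N.
Local Notation d := (n %/ k)%N.
Local Notation T := ('I_m * 'I_k * 'I_d)%type.

Lemma sum_enum_valT (F : T -> S) :
  \sum_(i < #|{: T}|) F (enum_val i) = \sum_a \sum_b \sum_c F (a, b, c).
Proof. by rewrite -(big_enum_val (A := {: T})) -sum_prod3. Qed.

Lemma natr_degree_inl (j : 'I_k) :
  (degree (@corona_edge n k m) (inl j))%:R = (m * d)%:R :> S.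
Proof.
rewrite natr_degree big_sumType /= big1 // add0r sum_prod3 /=.
under eq_bigr => t _ do under eq_bigr => i _ do
  rewrite sumr_const card_ord -[_ *+ _]mulr_natr eq_sym.
under eq_bigr => t _ do rewrite (sum_eq_mulr j (fun=> d%:R)).
by rewrite sumr_const card_ord -mulrnA mulnC.
Qed.

Lemma natr_degree_inr (p : T) :
  (degree (@corona_edge n k m) (inr p))%:R = n%:R :> S.
Proof.
case: p => -[t j] s; rewrite natr_degree big_sumType /=.
under eq_bigr => i _ do rewrite -[_%:R]mulr1.
rewrite (sum_eq_mulr j (fun=> 1)) sum_prod3 /=.
rewrite (bigD1 t) //= [X in _ + (_ + X)]big1 => [|t' /negPf]; last first.
  by rewrite eq_sym => ->; rewrite big1 // => j' _; rewrite big1.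
rewrite addr0 eqxx /= pair_bigA /=.
transitivity (1 + \sum_(q : 'I_k * 'I_d | q != (j, s)) (1 : S)).
  congr (_ + _); rewrite [RHS]big_mkcond; apply: eq_bigr => -[j' s'] _.
  by rewrite eq_sym; case: eqP.
(* The neighbour u_j makes up for the vertex itself, which is missing from its own clique. *)
transitivity (\sum_(q : 'I_k * 'I_d) (1 : S)).
  by rewrite [RHS](bigD1 (j, s)).
by rewrite sumr_const card_prod !card_ord mulnC divnK.
Qed.

(** Lists the u_j before the v_{t,j,s}, which exposes the block form. *)
Definition corona_of_ord (i : 'I_(k + #|{: T}|)) : corona_vertex n k m :=
  match split i with inl j => inl j | inr p => inr (enum_val p) end.

Lemma corona_of_ord_bij : bijective corona_of_ord.
Proof.
exists (fun v => unsplit (match v with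
  | inl j => inl j | inr p => inr (enum_rank p) end)) => [i|[j|p]].
- rewrite /corona_of_ord; case: (split_ordP i) => j ->; first by [].
  by rewrite enum_valK.
- by rewrite /corona_of_ord unsplitK.
- by rewrite /corona_of_ord unsplitK enum_rankK.
Qed.

Lemma corona_of_lshift j : corona_of_ord (lshift _ j) = inl j.
Proof. by rewrite /corona_of_ord (unsplitK (inl j)). Qed.

Lemma corona_of_rshift p : corona_of_ord (rshift _ p) = inr (enum_val p).
Proof. by rewrite /corona_of_ord (unsplitK (inr p)). Qed.

Definition corona_pos_mx : 'M[S]_(k, #|{: T}|) :=
  \matrix_(j, p) ((enum_val p).1.2 == j)%:R.

Definition corona_clique_mx : 'M[S]_(#|{: T}|, m) :=
  \matrix_(p, t) ((enum_val p).1.1 == t)%:R.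

Local Notation Q := corona_pos_mx.
Local Notation P := corona_clique_mx.

(** The u_j have pairwise disjoint neighbourhoods, each of size [m * d]. *)
Lemma corona_pos_gram : Q *m Q^T = (m * d)%:R%:M.
Proof.
apply/matrixP=> i j; rewrite !mxE; under eq_bigr do rewrite !mxE.
rewrite (sum_enum_valT (fun p => (p.1.2 == i)%:R * (p.1.2 == j)%:R)) /=.
under eq_bigr => t _ do under eq_bigr => j' _ do
  rewrite sumr_const card_ord -mulrnAr.
under eq_bigr => t _ do rewrite (sum_eq_mulr i (fun j' => (j' == j)%:R *+ d)).
by rewrite sumr_const card_ord -!mulrnA mulnC (mulnC m).
Qed.

(** The cliques are disjoint, each with [k * d = n] vertices. *)
Lemma corona_clique_gram : P^T *m P = n%:R%:M.
Proof.
apply/matrixP=> i j; rewrite !mxE; under eq_bigr do rewrite !mxE.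
rewrite (sum_enum_valT (fun p => (p.1.1 == i)%:R * (p.1.1 == j)%:R)) /=.
under eq_bigr => t _.
  under eq_bigr => j' _ do rewrite sumr_const card_ord.
  rewrite sumr_const card_ord -mulrnA divnK // -mulrnAr; over.
by rewrite (sum_eq_mulr i (fun t => (t == j)%:R *+ n)) mulrnAC.
Qed.

(** Each u_j has exactly [d] neighbours in every clique. *)
Lemma corona_pos_clique : Q *m P = const_mx d%:R.
Proof.
apply/matrixP=> i j; rewrite !mxE; under eq_bigr do rewrite !mxE mulrC.
rewrite (sum_enum_valT (fun p => (p.1.1 == j)%:R * (p.1.2 == i)%:R)) /=.
under eq_bigr => t _.
  under eq_bigr => j' _ do rewrite sumr_const card_ord mulrC -mulrnAr.
  rewrite (sum_eq_mulr i (fun=> (t == j)%:R *+ d)) -mulr_natr; over.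
by rewrite (sum_eq_mulr j (fun=> d%:R)).
Qed.

End Corona.

(** * The characteristic polynomial of the Laplacian *)

Lemma char_poly_corona (R : comNzRingType) (n k m : nat) : (k %| n)%N ->
  let Q := corona_pos_mx {poly R} n k m in
  let P := corona_clique_mx {poly R} n k m in
  char_poly (laplacian_mx R (@corona_edge n k m)) =
    \det (block_mx ('X - (m * (n %/ k))%:R)%:M Q Q^T
                   (('X - (n + 1)%:R)%:M + P *m P^T)).
Proof.
move=> k_dvd_n Q P; pose e := @corona_edge n k m.
(* The entries of x I - L as a function of two vertices, ready for reindexing. *)
pose f x y : {poly R} := ('X - (degree e x)%:R) *+ (x == y) + (e x y)%:R.
transitivity (\det (\matrix_(i < #|corona_vertex n k m|, j < #|corona_vertex n k m|)
    f (enum_val i) (enum_val j))).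
  congr (\det _); apply/matrixP=> i j; rewrite !mxE /f (inj_eq enum_val_inj).
  rewrite rmorphB rmorphMn rmorph_nat /= polyC_natr opprB addrA addrAC -mulrnBl.
  by [].
rewrite (det_enum_val_reindex f (@corona_of_ord_bij n k m)).
congr (\det _); apply/matrixP=> i j; rewrite mxE.
case: (split_ordP i) => {}i ->; case: (split_ordP j) => {}j ->.
- rewrite block_mxEul !corona_of_lshift /f natr_degree_inl !mxE.
  by rewrite addr0.
- rewrite block_mxEur corona_of_lshift corona_of_rshift /f !mxE.
  by rewrite mulr0n add0r; case: (enum_val j) => -[t j'] s /=; rewrite eq_sym.
- rewrite block_mxEdl corona_of_lshift corona_of_rshift /f !mxE.
  by rewrite mulr0n add0r; case: (enum_val i) => -[t j'] s /=; rewrite eq_sym.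
(* The diagonal entry ['X - n] splits as ['X - (n + 1)] plus 1; the ones complete the adjacency of
   the cliques to [P *m P^T]. *)
- rewrite block_mxEdr !corona_of_rshift /f natr_degree_inr // !mxE.
  under eq_bigr do rewrite !mxE eq_sym.
  rewrite (sum_eq_mulr _ (fun t => ((enum_val j).1.1 == t)%:R)).
  rewrite -(inj_eq enum_val_inj) /e.
  case: (enum_val i) (enum_val j) => -[t a] s [[t' a'] s'] /=.
  rewrite (eq_sym t') (inj_eq (@inr_inj _ _)) !xpair_eqE natrD.
  case: (t == t'); case: (a == a'); case: (s == s');
    by rewrite /= ?mulr0n ?mulr1n; ring.
Qed.

Theorem theorem5p3 (R : comNzRingType) (n m k : nat)
    (n_gt0 : (0 < n)%N) (m_gt0 : (0 < m)%N) (k_gt0 : (0 < k)%N)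
    (k_dvd_n : (k %| n)%N) :
  let d := (n %/ k)%N in
  char_poly (laplacian_mx R (@corona_edge n k m)) =
    'X * ('X - 1) ^+ (m - 1)
    * ('X - (n + 1)%:R) ^+ (m * (n - 1) + 1 - k)
    * ('X - (m * d + 1)%:R)
    * ('X^2 - (m * d + n + 1)%:R * 'X + (m * d * n)%:R) ^+ (k - 1)
  :> {poly R}.
Proof.
move=> d; rewrite char_poly_corona //.
have := det_bordered_gram ('X - (m * d)%:R) ('X - (n + 1)%:R)
  (corona_pos_gram {poly R} n k m) (corona_clique_gram {poly R} m k_dvd_n)
  (corona_pos_clique {poly R} n k m).
have def_n : n = (k * d)%N by rewrite mulnC divnK.
rewrite /= -/d; move: (\det _) => D; rewrite !card_prod !card_ord -/d.
set a := 'X - (n + 1)%:R.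
have -> : a + n%:R = 'X - 1 by rewrite /a natrD; ring.
set b := 'X^2 - _ + _.
have -> : a * ('X - (m * d)%:R) - (m * d)%:R = b.
  by rewrite /a /b !(natrD, natrM); ring.
(* As [n = k * d], the added constant is [m * d * n]; it cancels the constant term of the cubic,
   which then factors. *)
have -> : ('X - 1) * b + d%:R ^+ 2 *+ m *+ k = 'X * a * ('X - (m * d + 1)%:R).
  rewrite /a /b def_n !(natrD, natrM) -[_ *+ k]mulr_natr -[_ *+ m]mulr_natr.
  by ring.
have mon_c : 'X - 1 \is @monic R by rewrite -polyC1 monicXsubC.
have mon_a : a \is monic by rewrite /a -polyC_natr monicXsubC.
have mon_b : b \is monic.
  rewrite monicE /b -addrA lead_coefDl ?lead_coefXn //.
  rewrite size_polyXn -mulNr -!polyC_natr -polyCN size_MXaddC.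
  by case: ifP => // _; rewrite !ltnS size_polyC_leq1.
(* This is the multiplier of the determinant in [det_bordered_gram]; being monic, it cancels even in
   the presence of zero divisors. *)
have mon_u : ('X - 1) * b * ((a * ('X - 1)) ^+ k * a ^+ m) \is monic.
  by rewrite !(monicMr, monic_exp).
move=> eq_u; apply: (monic_lreg mon_u); rewrite -[LHS]mulrA eq_u.
(* The [+ 1] on the left counts the factor [a] of the cubic. The truncated subtraction of [k] is
   exact, since [k <= n <= m * (n - 1) + 1]. *)
have exp_a : (m * k * d + 1 = m * (n - 1) + 1 - k + k + m)%N.
  have le_kn : (k <= n)%N := dvdn_leq n_gt0 k_dvd_n.
  have : (m * (n - 1) + m = m * k * d)%N.
    by rewrite -mulnSr -mulnA -def_n subn1 prednK.
  have : (n - 1 <= m * (n - 1))%N by rewrite leq_pmull.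
  by move: (m * (n - 1))%N (m * k * d)%N; lia.
have pow_a :
    a ^+ (m * k * d) * a = a ^+ (m * (n - 1) + 1 - k) * a ^+ k * a ^+ m.
  by rewrite -exprSr -addn1 exp_a !exprD.
have pow_pred (x : {poly R}) i : (0 < i)%N -> x ^+ i = x * x ^+ (i - 1).
  by move=> i_gt0; rewrite -exprS subn1 prednK.
transitivity (a ^+ (m * k * d) * a * ('X - 1) ^+ m * (('X - 1) * b) ^+ k
  * 'X * ('X - (m * d + 1)%:R)); first by rewrite exprMn; ring.
rewrite pow_a !exprMn (pow_pred b k) // (pow_pred ('X - 1) m) //.
by ring.
Qed.
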